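(* Let $M\ge 1$ be an integer. There exist constants $c_M>1$ and $C>0$ (depending on $M$) such that $E(2^{Z_n})/c_M^{\,n}\to C$ as $n\to\infty$. In the case $M=2$, $c_2=\tfrac43$.
   Context: $J=(J_0,J_1,J_2,\dots)$ and $K=(K_0,K_1,K_2,\dots)$ are independent random walks on $\mathbb Z$ with $J_0=K_0=0$ and i.i.d. steps uniformly distributed on $\{1,2,\dots,M\}$. $Z_n=|\{1\le l\le n: J_l=K_l\}|$ is the number of visits to zero between times $1$ and $n$ made by the random walk $J-K$. *)

(* Defs.v *)
From HB Require Import structures.
From mathcomp Require Import all_boot all_order all_algebra.
From mathcomp Require Import finmap.
From mathcomp Require Import all_classical all_reals all_analysis.

Set Implicit Arguments.
Unset Strict Implicit.
Unset Printing Implicit Defensive.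

Import Order.TTheory GRing.Theory Num.Theory.
Import numFieldNormedType.Exports.

Local Open Scope classical_set_scope.
Local Open Scope ring_scope.

(* A [measurableType] is pointed, and [int] comes without a point. *)
HB.instance Definition _ := isPointed.Build int 0.

(* The integers carry the discrete sigma-algebra, like [bool] and [nat]. *)
HB.instance Definition _ := @isMeasurable.Build default_measure_display
  int discrete_measurable discrete_measurable0
  discrete_measurableC discrete_measurableU.

Section Walks.
Context (d : measure_display) (T : measurableType d) (R : realType).
Variable P : probability T R.

Definition mutually_independent (X : nat -> {RV P >-> int}) : Prop :=
  forall (I : {fset nat}) (A : nat -> set int),
    (forall i, measurable (A i)) ->
    P (\bigcap_(i in [set` I]) (X i @^-1` A i)) =
    (\prod_(i <- I) P (X i @^-1` A i))%E.

Definition sigma_process (X : nat -> {RV P >-> int}) : set (set T) :=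
  <<s [set E | exists (n : nat) (A : set int),
                 measurable A /\ E = X n @^-1` A] >>.

(* Independence of the processes as a whole, i.e. of the sigma-algebras they
   generate, not merely of [X n] and [Y n] for each [n]. *)
Definition independent_processes (X Y : nat -> {RV P >-> int}) : Prop :=
  forall A B : set T, sigma_process X A -> sigma_process Y B ->
    P (A `&` B) = (P A * P B)%E.

(* Only the law is prescribed: [X] may leave {1, ..., M} on a null set. *)
Definition uniformly_distributed (M : nat) (X : {RV P >-> int}) : Prop :=
  forall k : int, P (X @^-1` [set k]) =
    (if 1 <= k <= M%:Z then (M%:R : R)^-1 else 0)%:E.

Definition uniform_walk (M : nat) (S : nat -> {RV P >-> int}) : Prop :=
  (forall w, S 0%N w = 0) /\
  exists X : nat -> {RV P >-> int},
    [/\ forall n w, S n.+1 w = S n w + X n w,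
        mutually_independent X &
        forall n, uniformly_distributed M (X n)].

Definition visits (J K : nat -> {RV P >-> int}) (n : nat) (w : T) : nat :=
  #|[pred l : 'I_n.+1 | (1 <= l)%N && (J l w == K l w)]|.

End Walks.

(* Main.v *)
Require Import Defs.
From HB Require Import structures.
From mathcomp Require Import all_boot all_order all_algebra.
From mathcomp Require Import finmap.
From mathcomp Require Import all_classical all_reals all_analysis.
From mathcomp Require Import measurable_realfun zify ring lra.

(* Let u_k be the probability that J_k = K_k. Counting sets of visit times by
   their smallest element gives the renewal equation
   E 2^Z_n = 1 + sum_(1 <= k <= n) u_k E 2^Z_(n-k). By Cauchy-Schwarz u_k is at
   least 1/(kM+1), so sum u_k diverges and some s < 1 satisfies
   sum_(k >= 1) u_k s^k = 1. Then E 2^Z_n s^n solves a renewal equation for the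
   probability weights u_k s^k, which have a positive weight at 1 and finite
   mean; it converges by the renewal theorem, and c_M = 1/s. For M = 2 the Green
   function at s = 3/4 is computed from the explicit solution (1/3)^|x|. *)

Set Implicit Arguments.
Unset Strict Implicit.
Unset Printing Implicit Defensive.

Import Order.TTheory GRing.Theory Num.Theory.
Import numFieldNormedType.Exports.

Local Open Scope classical_set_scope.
Local Open Scope ring_scope.

(** * The renewal theorem *)

(** The window from [K] to [n] is a difference of two partial sums, hence at most the limit minus
    [series r K]. *)
Lemma nneg_series_tail (R : realType) (r : R ^nat) (eta : R) :
  (forall n, 0 <= r n) -> cvgn (series r) -> 0 < eta ->
  exists K, forall n, \sum_(k < n | (K <= k)%N) r k <= eta.
Proof.
move=> r0 rcvg eta0.
have [K _ HK] : \forall n \near \oo, `|limn (series r) - series r n| < eta.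
  by move/cvgrPdist_lt: (rcvg); apply.
exists K => n; pose m := maxn n K.
have le_lim : series r m <= limn (series r).
  by apply: nondecreasing_cvgn_le => //; apply: nondecreasing_series.
have := HK K (leqnn K); rewrite ltr_norml => /andP[_ hK].
have hm : \sum_(k < n | (K <= k)%N) r k <= \sum_(k < m | (K <= k)%N) r k.
  rewrite (big_ord_widen_cond m (fun k => K <= k)%N r (leq_maxl n K)).
  rewrite [leLHS]big_mkcond [leRHS]big_mkcond; apply: ler_sum => k _.
  by case: ifP => [/andP[-> _]//|_]; case: ifP.
apply: (le_trans hm); rewrite -(big_mkord (fun k => K <= k)%N r).
suff -> : \sum_(0 <= k < m | (K <= k)%N) r k = series r m - series r K by lra.
have hKm : (K <= m)%N by apply: leq_maxr.
rewrite -(big_nat_widenl K 0 m xpredT r) // /series /=.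
by rewrite [in RHS](big_cat_nat (n := K))//= addrAC subrr add0r.
Qed.

(** The sum is cut at [K]: indices [k >= K] carry little mass of [p] and meet the bound [G], while
    for [k < K] the argument [n - k] is large and [g] is small there. *)
Lemma cvg_convolution0 (R : realType) (p g : R ^nat) (G : R) :
  (forall n, 0 <= p n) -> (forall n, \sum_(k < n) p k <= 1) ->
  (forall n, 0 <= g n <= G) -> g n @[n --> \oo] --> 0 ->
  \sum_(k < n.+1) p k * g (n - k)%N @[n --> \oo] --> 0.
Proof.
move=> p0 p1 gG g0.
have pcvg : cvgn (series p).
  apply: nondecreasing_is_cvgn; first exact: nondecreasing_series.
  by exists 1 => _ [n _ <-]; rewrite /series /= big_mkord.
have G0 : 0 <= G by have /andP[] := gG 0%N; apply: le_trans.
apply/cvgrPdist_lt => eps eps0.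
have eta0 : 0 < eps / 2 / (G + 1) by rewrite !divr_gt0//; lra.
have [K HK] := nneg_series_tail p0 pcvg eta0.
have [N _ HN] : \forall n \near \oo, `|0 - g n| < eps / 4.
  by move/cvgrPdist_lt: g0; apply; lra.
exists (N + K)%N => // n /= NKn.
have term (k : 'I_n.+1) : p k * g (n - k)%N <=
    eps / 4 * p k + G * (if (K <= k)%N then p k else 0).
  have /andP[gk0 gkG] := gG (n - k)%N; have pk0 := p0 k.
  case: leqP => Kk; first by rewrite mulrC; nra.
  have := HN (n - k)%N; rewrite sub0r normrN ger0_norm// => /(_ _)/ltW h.
  rewrite mulr0 addr0 mulrC ler_wpM2r// h//=.
  by move: NKn Kk; lia.
rewrite sub0r normrN ger0_norm; last first.
  by apply: sumr_ge0 => k _; rewrite mulr_ge0//; case/andP: (gG (n - k)%N).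
apply: le_lt_trans (ler_sum _ (fun k _ => term k)) _.
rewrite big_split/= -!mulr_sumr -big_mkcond/=.
have h1 := p1 n.+1; have h2 := HK n.+1.
have h3 : G * (eps / 2 / (G + 1)) <= eps / 2.
  by rewrite mulrA ler_pdivrMr; nra.
have h4 := ler_wpM2l G0 h2.
have h5 : eps / 4 * (\sum_(i < n.+1) p i) <= eps / 4 by nra.
lra.
Qed.

(** In the applications [p k] is the weight of the waiting time [k+1] and [r k] the mass of the
    waiting times above [k]. The convolution of [e] with [r] moves by exactly the defect of [e] in
    the renewal equation. *)
Lemma renewal_telescope (R : pzRingType) (p r e : nat -> R) (n : nat) :
  r 0%N = 1 -> (forall n, r n.+1 = r n - p n) ->
  \sum_(k < n.+2) r k * e (n.+1 - k)%N =
  \sum_(k < n.+1) r k * e (n - k)%N +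
  (e n.+1 - \sum_(k < n.+1) p k * e (n - k)%N).
Proof.
move=> r0 rS; rewrite big_ord_recl/= r0 mul1r subn0 addrCA; congr +%R.
rewrite -sumrB; apply: eq_bigr => k _.
by rewrite /bump /= add1n subSS rS mulrBl.
Qed.

(* If the limit superior [L] of [|e|] were positive, then [e] would stay close
   to [L] or to [-L] on arbitrarily long windows, because [p 0 > 0] passes
   closeness to [L] from time [n+1] to time [n]. The sums of the hypothesis
   would then not tend to 0. *)
Lemma renewal_null (R : realType) (p r e : R ^nat) (B : R) :
  0 < p 0%N -> (forall n, 0 <= p n) -> (forall n, 0 <= r n) ->
  r 0%N = 1 -> (forall n, r n.+1 = r n - p n) -> cvgn (series r) ->
  (forall n, `|e n| <= B) ->
  \sum_(k < n.+1) r k * e (n - k)%N @[n --> \oo] --> 0 ->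
  e n @[n --> \oo] --> 0.
Proof.
move=> p00 p0 r_ge0 r0 rS rcvg eB T0.
set T := fun n : nat => \sum_(k < n.+1) r k * e (n - k)%N in T0.
have sum_p n : \sum_(k < n) p k = 1 - r n.
  elim: n => [|n IH]; first by rewrite big_ord0 r0 subrr.
  by rewrite big_ord_recr/= IH rS; lra.
have sum_p_le1 n : \sum_(k < n) p k <= 1 by rewrite sum_p; have := r_ge0 n; lra.
(* The infimum [L] of these eventual bounds is the limit superior of [|e|]. *)
pose E := [set x : R | exists N, forall n, (N <= n)%N -> `|e n| <= x].
have E_lb : lbound E 0.
  by move=> x [N /(_ N (leqnn N))]; apply: le_trans.
have E_inf : has_inf E by split; [exists B, 0%N | exists 0].
pose L := inf E.
have L0 : 0 <= L by apply: lb_le_inf => //; case: E_inf.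
have e_le eps : 0 < eps -> exists N, forall n, (N <= n)%N -> `|e n| < L + eps.
  move=> eps0; have [x [N HN] xL] := inf_adherent eps0 E_inf.
  by exists N => n /HN h; apply: le_lt_trans xL.
have e_ge eps N : 0 < eps -> exists2 n, (N <= n)%N & L - eps < `|e n|.
  move=> eps0; apply: contrapT => H.
  have : L <= L - eps; last by lra.
  apply: ge_inf; first by case: E_inf.
  exists N => n Nn; rewrite leNgt; apply/negP => h; by apply: H; exists n.
pose g n := Num.max 0 (`|e n| - L).
have g_bound n : 0 <= g n <= B.
  rewrite /g le_max lexx/= ge_max.
  have := eB n; have := normr_ge0 (e n); move=> ? ?; apply/andP; split; lra.
have g0 : g n @[n --> \oo] --> 0.
  apply/cvgrPdist_lt => eps eps0; have [N HN] := e_le _ eps0.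
  exists N => // n /= /HN h; have /andP[gn0 _] := g_bound n.
  by rewrite sub0r normrN ger0_norm// /g gt_max eps0/=; lra.
pose h n := e n.+1 - \sum_(k < n.+1) p k * e (n - k)%N.
have h0 : h n @[n --> \oo] --> 0.
  have -> : h = (fun n => T n.+1 - T n).
    by apply/funext => n; rewrite /T (renewal_telescope e n r0 rS) addrC addKr.
  rewrite -[X in _ --> X](subrr 0); apply: cvgB => //.
  by have := cvg_shiftS T (nbhs (0:R)); rewrite /= => ->.
pose z n := `|h n| + \sum_(k < n.+1) p k * g (n - k)%N.
have z0 : z n @[n --> \oo] --> 0.
  rewrite -[X in _ --> X]addr0; apply: cvgD.
    by have := cvg_norm h0; rewrite normr0; apply.
  exact: cvg_convolution0 g_bound g0.
(* The sign treats closeness to [L] and to [-L] at once. The terms other than the one of weight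
   [p 0] are at most [L] up to [g], with total weight at most [1 - p 0]; so a deficit at time [n]
   passes to time [n+1] with factor [p 0], up to [z]. *)
have step (b : bool) n :
    p 0%N * (L - (-1) ^+ b * e n) <= L - (-1) ^+ b * e n.+1 + z n.
  have sg_le (x : R) : (-1) ^+ b * x <= `|x|.
    by rewrite (le_trans (ler_norm _))// normrM normr_sign mul1r.
  have -> : e n.+1 = h n + \sum_(k < n.+1) p k * e (n - k)%N by rewrite /h subrK.
  have hh := sg_le (h n).
  have hs : (-1) ^+ b * (\sum_(k < n.+1) p k * e (n - k)%N) <=
     p 0%N * ((-1) ^+ b * e n) + (1 - p 0%N) * L + \sum_(k < n.+1) p k * g (n - k)%N.
    rewrite big_ord_recl [in leRHS]big_ord_recl subn0 /= mulrDr.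
    have /andP[gn0 _] := g_bound n.
    have : (-1) ^+ b * (\sum_(i < n) p (bump 0 i) * e (n - bump 0 i)%N) <=
       L * (\sum_(i < n) p (bump 0 i)) + \sum_(i < n) p (bump 0 i) * g (n - bump 0 i)%N.
      rewrite !mulr_sumr -big_split/=; apply: ler_sum => k _.
      rewrite mulrCA [L * _]mulrC -mulrDr ler_wpM2l//.
      by apply: (le_trans (sg_le _)); rewrite /g -lerBlDl le_max lexx orbT.
    have := sum_p_le1 n.+1; rewrite big_ord_recl/= => hp.
    have hL : L * (\sum_(i < n) p (bump 0 i)) <= (1 - p 0%N) * L.
      by rewrite [leRHS]mulrC ler_wpM2l//; lra.
    have : 0 <= p 0%N * g n by rewrite mulr_ge0.
    lra.
  by rewrite /z mulrDr; lra.
have window K eps : 0 < eps -> exists2 delta, 0 < delta & exists N, forall n (b : bool),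
    (N <= n)%N -> L - delta < (-1) ^+ b * e n ->
    forall i, (i <= K)%N -> L - eps < (-1) ^+ b * e (n - i)%N.
  elim: K eps => [|K IH] eps eps0.
    exists eps => //; exists 0%N => n b _ hn i; rewrite leqn0 => /eqP ->.
    by rewrite subn0.
  (* Half of [eps * p 0] goes to the closeness at time [n - K], half to [z]; dividing by [p 0]
     leaves [eps]. *)
  have q0 : 0 < eps * p 0%N / 2 by rewrite divr_gt0// mulr_gt0.
  have [|delta delta0 [N HN]] := IH (Num.min eps (eps * p 0%N / 2)).
    by rewrite lt_min eps0.
  have [N' _ HN'] : \forall n \near \oo, `|0 - z n| < eps * p 0%N / 2.
    by move/cvgrPdist_lt: z0; apply.
  exists delta => //; exists (maxn N (N' + K.+1)) => n b Nn hn i.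
  have {}HN := HN n b (leq_trans (leq_maxl _ _) Nn) hn.
  rewrite leq_eqVlt ltnS => /orP[/eqP -> {i}|/HN]; last first.
    by apply: le_lt_trans; rewrite lerB// ge_min lexx.
  have := HN K (leqnn K).
  have nK : (N' + K.+1 <= n)%N by apply: leq_trans Nn; exact: leq_maxr.
  have -> : (n - K = (n - K.+1).+1)%N by lia.
  have /HN' /= : (N' <= n - K.+1)%N by lia.
  rewrite sub0r normrN => /(le_lt_trans (ler_norm _)) hz hm.
  have hm' : L - eps * p 0%N / 2 < (-1) ^+ b * e (n - K.+1).+1.
    by apply: le_lt_trans hm; rewrite lerB// ge_min lexx orbT.
  have hst := step b (n - K.+1)%N.
  have : p 0%N * (L - (-1) ^+ b * e (n - K.+1)%N) < p 0%N * eps by lra.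
  by rewrite ltr_pM2l//; lra.
have B0 : 0 <= B by apply: le_trans (eB 0%N).
have [Lpos|] := ltP 0 L; last first.
  move=> Lle0; apply/cvgrPdist_lt => eps eps0; have [N HN] := e_le _ eps0.
  exists N => // n /= /HN; rewrite sub0r normrN; lra.
exfalso.
have eta0 : 0 < L / 8 / (B + 1) by rewrite !divr_gt0//; lra.
have [K HK] := nneg_series_tail r_ge0 rcvg eta0.
have [|delta delta0 [N HN]] := window K (L / 2); first by lra.
have [N' _ HN'] : \forall n \near \oo, `|0 - T n| < L / 8.
  by move/cvgrPdist_lt: T0; apply; lra.
have [n Nn hn] := e_ge delta (maxn N (N' + K)) delta0.
pose b := e n < 0.
have hb : (-1) ^+ b * e n = `|e n| by rewrite -normrEsign.
have {HN} HN := HN n b (leq_trans (leq_maxl _ _) Nn).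
rewrite hb in HN; move/(_ hn) in HN.
(* The term at 0 gives [L / 2] because [r 0 = 1], the other terms below [K] are nonnegative, and the
   tail costs at most [L / 8] in total. Hence [|T n|] is at least [3 L / 8], against
   [|T n| < L / 8]. *)
have term (k : 'I_n.+1) : (k == ord0)%:R * (L / 2) - B * (if (K <= k)%N then r k else 0)
    <= r k * ((-1) ^+ b * e (n - k)%N).
  have rk0 := r_ge0 k.
  have hB : - B <= (-1) ^+ b * e (n - k)%N.
    by apply: lerNnormlW; rewrite normrM normr_sign mul1r.
  have [Kk|kK] := leqP K k.
    have [k0|k0] := eqVneq k ord0; last by rewrite mul0r; nra.
    have := HN 0%N (leq0n _); rewrite subn0 k0 /= subn0 mul1r r0 mul1r mulr1; lra.
  have := HN k (ltnW kK).
  have [->|k0] := eqVneq k ord0; first by rewrite /= subn0 r0; lra.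
  by rewrite mul0r mulr0; nra.
have /HN' /= : (N' <= n)%N.
  by rewrite (leq_trans _ Nn)// (leq_trans _ (leq_maxr _ _))// leq_addr.
rewrite sub0r normrN => hT.
have : (-1) ^+ b * T n <= `|T n|.
  by rewrite (le_trans (ler_norm _))// normrM normr_sign mul1r.
have /(_ (index_enum _)) := ler_sum _ (fun k (_ : xpredT k) => term k). 
rewrite sumrB -mulr_suml -mulr_sumr -big_mkcond/=.
rewrite (bigD1 ord0)//= big1 ?addr0 ?mul1r; last by move=> i /negPf ->.
rewrite [in leRHS](eq_bigr (fun k : 'I_n.+1 => (-1) ^+ b * (r k * e (n - k)%N)));
  last by move=> k _; rewrite mulrCA.
rewrite -mulr_sumr.
have := ler_wpM2l B0 (HK n.+1).
have : B * (L / 8 / (B + 1)) <= L / 8 by rewrite mulrA ler_pdivrMr; nra.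
by move: hT; rewrite /T; lra.
Qed.

(** The convolution of [b] with [r] telescopes to the partial sums of [g]. For [b - G / mu] the
    convolution therefore tends to [G - (G / mu) * mu = 0], and [renewal_null] applies. The sum [mu]
    of the tails is the mean waiting time. *)
Theorem renewal_cvg (R : realType) (p r g b : R ^nat) (G mu : R) :
  0 < p 0%N -> (forall n, 0 <= p n) -> (forall n, 0 <= r n) ->
  r 0%N = 1 -> (forall n, r n.+1 = r n - p n) -> (forall n, 0 <= g n) ->
  series r n @[n --> \oo] --> mu -> series g n @[n --> \oo] --> G ->
  b 0%N = g 0%N ->
  (forall n, b n.+1 = g n.+1 + \sum_(k < n.+1) p k * b (n - k)%N) ->
  b n @[n --> \oo] --> G / mu.
Proof.
move=> p00 p0 r_ge0 r0 rS g_ge0 rmu gG b0 bS.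
have rcvg : cvgn (series r) by apply/cvg_ex; exists mu.
have mu1 : 1 <= mu.
  have : series r 1 <= limn (series r).
    by apply: nondecreasing_cvgn_le => //; apply: nondecreasing_series.
  by rewrite (cvg_lim _ rmu)// /series/= big_nat1 r0.
have conv_b n : \sum_(k < n.+1) r k * b (n - k)%N = series g n.+1.
  elim: n => [|n IH].
    by rewrite big_ord_recl big_ord0 /= subn0 r0 mul1r addr0 b0 /series/= big_nat1.
  rewrite (renewal_telescope b n r0 rS) IH bS addrK.
  by rewrite [RHS]/series/= big_nat_recr.
have b_ge0 n : 0 <= b n.
  elim/ltn_ind: n => -[_|n IH]; first by rewrite b0.
  rewrite bS addr_ge0// sumr_ge0// => k _; rewrite mulr_ge0// IH//.
  by rewrite ltnS leq_subr.
(* [b n] is the term of index 0 in its nonnegative convolution with [r]. *)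
have b_le n : `|b n| <= G.
  rewrite ger0_norm//; apply: (@le_trans _ _ (series g n.+1)).
    rewrite -conv_b big_ord_recl subn0 r0 mul1r lerDl sumr_ge0// => k _.
    by rewrite mulr_ge0.
  have gcvg : cvgn (series g) by apply/cvg_ex; exists G.
  rewrite -(cvg_lim _ gG)//; apply: nondecreasing_cvgn_le => //.
  exact: nondecreasing_series.
pose e n := b n - G / mu.
suff e0 : e n @[n --> \oo] --> 0.
  have -> : b = (fun n => e n + G / mu) by apply/funext => n; rewrite subrK.
  by have := cvgD e0 (cvg_cst (G / mu)); rewrite add0r; apply.
apply: (renewal_null (B := G + `|G / mu|) p00 p0 r_ge0 r0 rS rcvg).
  by move=> n; rewrite (le_trans (ler_normB _ _))// lerD2r.
have -> : (fun n => \sum_(k < n.+1) r k * e (n - k)%N) =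
    (fun n => series g n.+1 - G / mu * series r n.+1).
  apply/funext => n; rewrite -conv_b [X in _ - _ * X]/series/= big_mkord mulr_sumr -sumrB.
  by apply: eq_bigr => k _; rewrite /e mulrBr [r k * (G / mu)]mulrC.
have sh (u : R ^nat) (l : R) : u n @[n --> \oo] --> l -> u n.+1 @[n --> \oo] --> l.
  by move=> ul; have := cvg_shiftS u (nbhs l); rewrite /= => ->.
have := cvgB (sh _ _ gG) (cvgM (cvg_cst (G / mu)) (sh _ _ rmu)).
rewrite divfK ?subrr; last by rewrite gt_eqF// (lt_le_trans ltr01).
exact.
Qed.

(** * Root of a power series *)

Lemma subrX_le (R : realDomainType) (x y t : R) (k : nat) :
  0 <= x -> x <= y -> y <= t ->
  y ^+ k.+1 - x ^+ k.+1 <= (y - x) * (k.+1%:R * t ^+ k).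
Proof.
move=> x0 xy yt; rewrite subrXX ler_wpM2l ?subr_ge0//.
rewrite mulr_natl -[X in _ <= _ *+ X](card_ord k.+1) -sumr_const.
apply: ler_sum => i _.
have -> : t ^+ k = t ^+ (k - i) * t ^+ i by rewrite -exprD subnK ?leq_ord.
have y0 := le_trans x0 xy; have t0 := le_trans y0 yt.
by rewrite ler_pM ?exprn_ge0// lerXn2r ?nnegrE// (le_trans xy).
Qed.

(** The full series is [(1 - t)^-2] for [t < 1], and the explicit remainder is nonnegative. *)
Lemma sum_natrX_le (R : realDomainType) (t : R) (n : nat) :
  0 <= t -> t <= 1 -> (1 - t) ^+ 2 * (\sum_(k < n) k.+1%:R * t ^+ k) <= 1.
Proof.
move=> t0 t1.
have -> : (1 - t) ^+ 2 * (\sum_(k < n) k.+1%:R * t ^+ k) =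
    1 - t ^+ n * (1 + n%:R * (1 - t)).
  elim: n => [|n IH]; first by rewrite big_ord0 expr0; ring.
  by rewrite big_ord_recr/= mulrDr IH [t ^+ n.+1]exprS -[n.+1]addn1 natrD; ring.
rewrite lerBlDr lerDl mulr_ge0 ?exprn_ge0// addr_ge0// mulr_ge0//.
by rewrite subr_ge0.
Qed.

(** The root is the supremum of the points of [0, 1] at which all partial sums are at most 1. If the
    series were below 1 there, a slope bound uniform in [n] would allow a larger point. *)
Lemma power_series_root (R : realType) (u : R ^nat) :
  (forall n, 0 <= u n <= 1) -> (exists n, 1 < \sum_(k < n) u k) ->
  exists s : R, [/\ 0 < s, s < 1 &
    series (fun k => u k * s ^+ k.+1) n @[n --> \oo] --> (1 : R)].
Proof.
move=> u01 [N HN].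
have u0 n : 0 <= u n by case/andP: (u01 n).
pose F n s : R := \sum_(k < n) u k * s ^+ k.+1.
(* Used twice: with [t = 1] the slope bound depends on [n], with [t < 1] it is controlled uniformly
   in [n]. *)
have FB n x y t : 0 <= x -> x <= y -> y <= t ->
    F n y <= F n x + (y - x) * (\sum_(k < n) k.+1%:R * t ^+ k).
  move=> x0 xy yt; rewrite -lerBlDl -sumrB mulr_sumr; apply: ler_sum => k _.
  rewrite -mulrBr; apply: le_trans (subrX_le k x0 xy yt).
  rewrite ler_piMl//; last by case/andP: (u01 k).
  by rewrite subr_ge0 ler_pXn2r// nnegrE// (le_trans x0).
pose E := [set s : R | 0 <= s <= 1 /\ forall n, F n s <= 1].
have E0 : E 0.
  split=> [|n]; first by rewrite lexx ler01.
  by rewrite /F big1// => k _; rewrite expr0n mulr0.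
have E_sup : has_sup E by split; [exists 0 | exists 1 => x [/andP[]]].
pose s := sup E.
have s0 : 0 <= s by apply: ub_le_sup => //; case: E_sup.
have s1 : s <= 1 by apply: ge_sup; [exists 0|move=> x [/andP[]]].
have Fs n : F n s <= 1.
  rewrite leNgt; apply/negP => Fn.
  pose c : R := \sum_(k < n) k.+1%:R * 1 ^+ k.
  have c0 : 0 <= c by apply: sumr_ge0 => k _; rewrite expr1n mulr1.
  (* Within this distance to the left of [s], [F n] still exceeds 1, since [c] bounds its slope on
     [0, 1]. *)
  have eps0 : 0 < (F n s - 1) / (c + 1) by rewrite divr_gt0//; lra.
  have [x Ex xs] := sup_adherent eps0 E_sup.
  have xles : x <= s by apply: ub_le_sup => //; case: E_sup.
  case: Ex => /andP[x0 x1] /(_ n) Fx.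
  have := FB n x s 1 x0 xles s1; rewrite -/c.
  have : (s - x) * c <= (F n s - 1) / (c + 1) * c.
    by rewrite ler_wpM2r//; rewrite -/s in xs; lra.
  have : (F n s - 1) / (c + 1) * c < F n s - 1.
    by rewrite mulrAC ltr_pdivrMr; nra.
  lra.
have slt1 : s < 1.
  rewrite lt_neqAle s1 andbT; apply/eqP => se.
  have := Fs N; rewrite se /F (eq_bigr (fun k : 'I_N => u k));
    last by move=> k _; rewrite expr1n mulr1.
  lra.
have serF : series (fun k => u k * s ^+ k.+1) = F ^~ s.
  by apply/funext => n; rewrite /series /= big_mkord.
have Fcvg : cvgn (F ^~ s).
  rewrite -serF; apply: nondecreasing_is_cvgn.
    by apply: nondecreasing_series => n _ _; rewrite mulr_ge0 ?exprn_ge0.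
  by rewrite serF; exists 1 => _ [n _ <-].
pose l := limn (F ^~ s).
have Fl n : F n s <= l.
  apply: (nondecreasing_cvgn_le (u_ := F ^~ s)) => //.
  by rewrite -serF; apply: nondecreasing_series => k _ _; rewrite mulr_ge0 ?exprn_ge0.
have l1 : l <= 1 by apply: limr_le => //; apply: nearW.
have le : l = 1.
  apply/eqP; rewrite eq_le l1 leNgt; apply/negP => llt1.
  pose t := (1 + s) / 2.
  (* The first bound keeps [s + d] below [t]; the second lets every partial sum grow by at most
     [1 - l]. So [s + d] would lie in [E], above its supremum. *)
  pose d := Num.min (t - s) ((1 - l) * (1 - t) ^+ 2).
  have t1 : t < 1 by rewrite /t; lra.
  have ts : s < t by rewrite /t; lra.
  have t0 : 0 < (1 - t) ^+ 2 by rewrite exprn_gt0// subr_gt0.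
  have d0 : 0 < d.
    by rewrite lt_min mulr_gt0 ?andbT//; lra.
  have dt : d <= t - s by rewrite ge_min lexx.
  have dl : d <= (1 - l) * (1 - t) ^+ 2 by rewrite ge_min lexx orbT.
  have : s + d <= s; last by lra.
  apply: ub_le_sup; first by case: E_sup.
  split=> [|n]; first by apply/andP; split; lra.
  have sd : s <= s + d by lra.
  have sdt : s + d <= t by lra.
  have := FB n s (s + d) t s0 sd sdt.
  have S0 : 0 <= \sum_(k < n) k.+1%:R * t ^+ k.
    by apply: sumr_ge0 => k _; rewrite mulr_ge0// exprn_ge0//; lra.
  have := ler_wpM2r S0 dl; rewrite -mulrA.
  have tpos : 0 <= t by lra.
  have h1 : (1 - l) * ((1 - t) ^+ 2 * \sum_(k < n) k.+1%:R * t ^+ k) <= 1 - l.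
    by rewrite ler_piMr ?sum_natrX_le//; lra.
  have := Fl n; lra.
exists s; split => //; last by rewrite serF -le.
(* At 0 all partial sums vanish, so their limit could not be 1. *)
rewrite lt_neqAle s0 andbT eq_sym; apply/eqP => se.
move: le; rewrite /l se.
have -> : F ^~ 0 = cst 0.
  by apply/funext => n; rewrite /F big1// => k _; rewrite expr0n mulr0.
by rewrite lim_cst// => /eqP; rewrite eq_sym oner_eq0.
Qed.

(** * The difference walk *)

(* [step_mean], [return_prob] and [visit_mean] concern the walk J - K started at
   [x]: [return_prob n x] is the probability that it is at 0 at time [n], and
   [visit_mean n x] the mean of 2 to the number of visits to 0 at times 1..n. *)
Definition step_mean (R : realType) (M : nat) (f : int -> R) (x : int) : R :=
  (M%:R ^-1) ^+ 2 * \sum_(i < M) \sum_(j < M) f (x + i.+1%:Z - j.+1%:Z).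

Fixpoint return_prob (R : realType) (M n : nat) (x : int) : R :=
  if n is m.+1 then step_mean M (@return_prob R M m) x else (x == 0)%:R.

Fixpoint visit_mean (R : realType) (M n : nat) (x : int) : R :=
  if n is m.+1
  then step_mean M (fun y => 2 ^+ (y == 0) * @visit_mean R M m y) x else 1.

Arguments return_prob : clear implicits.
Arguments visit_mean : clear implicits.

Section Kernel.
Variables (R : realType) (M : nat).
Hypothesis M_gt0 : (0 < M)%N.

Lemma step_mean_cst (c : R) x : step_mean M (fun=> c) x = c.
Proof.
rewrite /step_mean !sumr_const card_ord -[_ *+ M]mulr_natr -[c *+ M]mulr_natr.
by field; rewrite pnatr_eq0 -lt0n.
Qed.

Lemma step_meanD (f g : int -> R) x :
  step_mean M (fun y => f y + g y) x = step_mean M f x + step_mean M g x.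
Proof.
rewrite /step_mean -mulrDr -big_split; congr (_ * _).
by apply: eq_bigr => i _; rewrite -big_split.
Qed.

Lemma step_meanZ (c : R) (f : int -> R) x :
  step_mean M (fun y => c * f y) x = c * step_mean M f x.
Proof.
rewrite /step_mean mulrCA; congr (_ * _); rewrite mulr_sumr.
by apply: eq_bigr => i _; rewrite mulr_sumr.
Qed.

Lemma step_mean_sum n (f : nat -> int -> R) x :
  step_mean M (fun y => \sum_(k < n) f k y) x = \sum_(k < n) step_mean M (f k) x.
Proof.
rewrite /step_mean -mulr_sumr [in RHS]exchange_big; congr (_ * _).
by apply: eq_bigr => i _; rewrite [RHS]exchange_big.
Qed.

Lemma step_mean_ext (f g : int -> R) x : f =1 g -> step_mean M f x = step_mean M g x.
Proof. by move=> /funext ->. Qed.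

Lemma step_mean_le (f g : int -> R) x :
  (forall y, f y <= g y) -> step_mean M f x <= step_mean M g x.
Proof.
move=> fg; rewrite /step_mean ler_wpM2l ?exprn_ge0//.
by apply: ler_sum => i _; apply: ler_sum.
Qed.

Lemma return_prob_bound n x : 0 <= return_prob R M n x <= 1.
Proof.
elim: n x => [|n IH] x /=; first by case: eqP; rewrite lexx ler01.
rewrite -{1}(step_mean_cst 0 x) -(step_mean_cst 1 x).
by rewrite !step_mean_le// => y; case/andP: (IH y).
Qed.

(** Both walks can take the step 1. This gives [p 0 > 0] in the renewal theorem, which rules out
    periodicity. *)
Lemma return_prob1_gt0 : 0 < return_prob R M 1 0.
Proof.
rewrite /= /step_mean mulr_gt0 ?exprn_gt0 ?invr_gt0 ?ltr0n//.
rewrite (bigD1 (Ordinal M_gt0))//= (bigD1 (Ordinal M_gt0))//=.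
rewrite -addrA ltr_wpDr// addr_ge0// ?sumr_ge0// => i _.
by rewrite sumr_ge0.
Qed.

(* [2 ^ Z_n] counts the sets of visit times; the sum classifies the nonempty
   ones by their smallest element. *)
Lemma visit_mean_renewal n x :
  visit_mean R M n x =
  1 + \sum_(k < n) return_prob R M k.+1 x * visit_mean R M (n - k.+1) 0.
Proof.
elim: n x => [|n IH] x; first by rewrite big_ord0 addr0.
rewrite [LHS]/=.
rewrite (_ : step_mean _ _ x = step_mean M (fun y => 1 + (
    \sum_(k < n.+1) (visit_mean R M (n - k) 0 * return_prob R M k y))) x); last first.
  apply: step_mean_ext => y; rewrite big_ord_recl /= subn0.
  (* The extra copy of [visit_mean R M n 0] at [y = 0] becomes the term [k = 0] of the enlarged sum;
     the induction hypothesis supplies the others. *)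
  have -> : 2 ^+ (y == 0) * visit_mean R M n y =
      visit_mean R M n y + visit_mean R M n 0 * (y == 0)%:R.
    by case: eqP => [->|_] /=; rewrite ?expr0 ?expr1; ring.
  rewrite {1}IH -addrA; congr (1 + _); rewrite addrC; congr (_ + _).
  by apply: eq_bigr => i _; rewrite /bump /= add1n mulrC.
rewrite step_meanD step_mean_cst
  (step_mean_sum n.+1 (fun k y => visit_mean R M (n - k) 0 * return_prob R M k y)).
congr (1 + _); apply: eq_bigr => k _.
by rewrite step_meanZ mulrC subSS.
Qed.

(** * Averages over pairs of step sequences *)

Lemma sum_tuple0 (A : finType) (F : 0.-tuple A -> R) :
  \sum_(t : 0.-tuple A) F t = F [tuple].
Proof.
by apply: big_pred1 => t; rewrite (tuple0 t); apply/esym/eqP.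
Qed.

Lemma sum_tuple_cons (A : finType) n (F : seq A -> R) :
  \sum_(t : n.+1.-tuple A) F t = \sum_(a : A) \sum_(t : n.-tuple A) F (a :: t).
Proof.
rewrite pair_big /=.
rewrite (reindex (fun p : A * n.-tuple A => [tuple of p.1 :: p.2])) /=.
  by apply: eq_bigr.
exists (fun t : n.+1.-tuple A => (thead t, [tuple of behead t])).
  by move=> [a t] _ /=; congr pair; apply: val_inj.
by move=> t _ /=; rewrite -tuple_eta.
Qed.

Lemma sum_tuple_cons2 (A : finType) n (F : seq A -> seq A -> R) :
  \sum_(s : n.+1.-tuple A) \sum_(t : n.+1.-tuple A) F s t =
  \sum_(a : A) \sum_(b : A)
    \sum_(s : n.-tuple A) \sum_(t : n.-tuple A) F (a :: s) (b :: t).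
Proof.
rewrite (sum_tuple_cons n (fun s => \sum_(t : n.+1.-tuple A) F s t)).
apply: eq_bigr => a _; rewrite [RHS]exchange_big; apply: eq_bigr => s _ /=.
exact: sum_tuple_cons.
Qed.

Definition walk_sum (a : seq 'I_M) : nat := \sum_(i <- a) i.+1.

Lemma walk_sum_cons i a : walk_sum (i :: a) = (i.+1 + walk_sum a)%N.
Proof. by rewrite /walk_sum big_cons. Qed.

(** For [x = 0] this form exposes returns as collisions between the sums of two step sequences. *)
Lemma return_prob_tuple n x :
  return_prob R M n x = (M%:R ^-1) ^+ (2 * n) *
    \sum_(a : n.-tuple 'I_M) \sum_(b : n.-tuple 'I_M)
      (x + (walk_sum a)%:Z - (walk_sum b)%:Z == 0)%:R.
Proof.
elim: n x => [|n IH] x.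
  rewrite muln0 expr0 mul1r !sum_tuple0.
  by rewrite /walk_sum big_nil addr0 subr0.
rewrite /= (step_mean_ext _ IH) step_meanZ /step_mean mulrA mulnS exprD.
rewrite [X in X * _ = _]mulrC.
congr (_ * _).
rewrite (sum_tuple_cons2 n
  (fun a b => (x + (walk_sum a)%:Z - (walk_sum b)%:Z == 0)%:R)).
apply: eq_bigr => i _; apply: eq_bigr => j _.
apply: eq_bigr => a _; apply: eq_bigr => b _; congr ((_ == _)%:R).
by rewrite !walk_sum_cons !PoszD; ring.
Qed.

(** The right side averages over equally likely pairs of paths, which is the shape in which the
    expectation is computed on the probability space. *)
Lemma visit_mean_tuple n x :
  visit_mean R M n x = (M%:R ^-1) ^+ (2 * n) *
    \sum_(a : n.-tuple 'I_M) \sum_(b : n.-tuple 'I_M)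
      2 ^+ (\sum_(l < n) (x + (walk_sum (take l.+1 a))%:Z
                            - (walk_sum (take l.+1 b))%:Z == 0%R)%R).
Proof.
elim: n x => [|n IH] x.
  rewrite muln0 expr0 mul1r !sum_tuple0.
  by rewrite big_ord0 expr0.
rewrite /= /step_mean mulnS exprD -mulrA; congr (_ * _).
rewrite (sum_tuple_cons2 n (fun a b => 2 ^+ (\sum_(l < n.+1)
  (x + (walk_sum (take l.+1 a))%:Z - (walk_sum (take l.+1 b))%:Z == 0%R)%R))).
rewrite mulr_sumr; apply: eq_bigr => i _; rewrite mulr_sumr.
apply: eq_bigr => j _; rewrite IH mulrCA; congr (_ * _).
rewrite mulr_sumr; apply: eq_bigr => a _; rewrite mulr_sumr.
apply: eq_bigr => b _; rewrite -exprD big_ord_recl /= !take0.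
congr (_ ^+ (_ + _)); first by rewrite !walk_sum_cons /walk_sum !big_nil !addn0.
apply: eq_bigr => l _; rewrite /bump /= add1n; congr (nat_of_bool (_ == _)).
by rewrite !walk_sum_cons !PoszD; ring.
Qed.

(** * Divergence of the sum of return probabilities *)

(** Cauchy-Schwarz for the fibre sizes [c y]: they add up to [#|T|], and their squares add up to the
    number of collisions. *)
Lemma collision_count (T : finType) N (f : T -> 'I_N) :
  #|T|%:R ^+ 2 <= N%:R * \sum_(a : T) \sum_(b : T) (f a == f b)%:R :> R.
Proof.
pose c y : R := \sum_(a : T) (f a == y)%:R.
have sum_c : \sum_y c y = #|T|%:R.
  rewrite exchange_big /= -sum1_card natr_sum; apply: eq_bigr => a _.
  by rewrite (bigD1 (f a))//= eqxx big1 ?addr0// => y /negPf; rewrite eq_sym => ->.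
have -> : \sum_(a : T) \sum_(b : T) (f a == f b)%:R = \sum_y c y ^+ 2.
  rewrite [RHS](eq_bigr (fun y => \sum_a \sum_b (f a == y)%:R * (f b == y)%:R)).
    rewrite [RHS]exchange_big; apply: eq_bigr => a _ /=.
    rewrite [RHS]exchange_big; apply: eq_bigr => b _ /=.
    rewrite (bigD1 (f a))//= eqxx mul1r eq_sym big1 ?addr0// => y /negPf.
    by rewrite eq_sym => ->; rewrite mul0r.
  move=> y _; rewrite expr2 mulr_suml; apply: eq_bigr => a _.
  by rewrite mulr_sumr.
case: N f @c sum_c => [|N] f c sum_c.
  by rewrite -sum_c big_ord0 expr0n /= mul0r.
set S : R := #|T|%:R in sum_c *.
pose m : R := S / N.+1%:R.
(* This sums [(c y - m)^2 >= 0], with [m] the mean fibre size. *)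
have : \sum_y (2 * m * c y - m ^+ 2) <= \sum_y c y ^+ 2.
  apply: ler_sum => y _; have := sqr_ge0 (c y - m); nra.
rewrite sumrB -mulr_sumr sum_c sumr_const card_ord -[_ *+ N.+1]mulr_natl.
have -> : 2 * m * S - N.+1%:R * m ^+ 2 = S ^+ 2 / N.+1%:R.
  by rewrite /m; field; rewrite addrC natr1 pnatr_eq0.
by rewrite ler_pdivrMr ?ltr0n// mulrC.
Qed.

Lemma walk_sum_le (a : seq 'I_M) : (walk_sum a <= size a * M)%N.
Proof.
elim: a => [|i a IH]; first by rewrite /walk_sum big_nil.
by rewrite walk_sum_cons /= mulSn leq_add// ltn_ord.
Qed.

(** The [M^n] step sequences have their sums among the [n M + 1] values 0, ..., n M, which forces
    many collisions. *)
Lemma return_prob0_ge n : (n * M).+1%:R^-1 <= return_prob R M n 0.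
Proof.
rewrite return_prob_tuple.
have lt_sum (a : n.-tuple 'I_M) : (walk_sum a < (n * M).+1)%N.
  by rewrite ltnS -{2}(size_tuple a) walk_sum_le.
pose f a := Ordinal (lt_sum a).
rewrite (eq_bigr (fun a => \sum_b (f a == f b)%:R)); last first.
  by move=> a _; apply: eq_bigr => b _; rewrite add0r subr_eq0.
have := collision_count f; rewrite card_tuple card_ord natrX => h.
rewrite exprVn mulrC ler_pdivlMr ?exprn_gt0 ?ltr0n//.
by rewrite mulrC ler_pdivrMr ?ltr0n// mulnC exprM [leRHS]mulrC.
Qed.

(** Since [k M + 1 <= 2 M k] for [k >= 1], partial sums bounded by 1 would make the harmonic series
    converge. *)
Lemma return_prob_diverges : exists n, 1 < \sum_(k < n) return_prob R M k.+1 0.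
Proof.
apply: contrapT => H.
have sum_le n : \sum_(k < n) return_prob R M k.+1 0 <= 1.
  by rewrite leNgt; apply/negP => h; apply: H; exists n.
apply: (@dvg_harmonic R).
apply: nondecreasing_is_cvgn.
  by apply: nondecreasing_series => k _ _; rewrite /harmonic /= invr_ge0.
exists (2 * M%:R) => _ [n _ <-]; rewrite /series /= big_mkord.
apply: (@le_trans _ _ (\sum_(k < n) 2 * M%:R * return_prob R M k.+1 0)).
  apply: ler_sum => k _; rewrite /harmonic /=.
  apply: le_trans (ler_wpM2l _ (return_prob0_ge k.+1)); last by rewrite mulr_ge0.
  rewrite ler_pdivlMr ?ltr0n// mulrC ler_pdivrMr ?ltr0n//.
  rewrite -!natrM ler_nat; nia.
by rewrite -mulr_sumr ler_piMr// mulr_ge0.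
Qed.

End Kernel.

(* [h x = (1/3) ^ |x|] satisfies [h = 1_{x = 0} / 2 + (3/4) * step_mean 2 h],
   so it is half of the Green function at [3/4]. *)
Lemma return_prob2_series (R : realType) :
  series (fun k => return_prob R 2 k.+1 0 * (3 / 4) ^+ k.+1) n @[n --> \oo] --> (1 : R).
Proof.
pose h (x : int) : R := 3^-1 ^+ `|x|%N.
pose c : R := 3 / 4.
have hE x : h x = 2^-1 * (x == 0)%:R + c * step_mean 2 h x.
  (* The difference of two steps is 0 with probability 1/2, and 1 or -1 with probability 1/4
     each. *)
  have step2 f : step_mean 2 f x = 4^-1 * (2 * f x + f (x + 1) + f (x - 1)) :> R.
    rewrite /step_mean !big_ord_recl !big_ord0 /= /bump /=.
    rewrite (_ : x + 1 - 2%:Z = x - 1); last by ring.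
    rewrite (_ : x + 2%:Z - 1 = x + 1); last by ring.
    by rewrite !addrK; field.
  rewrite step2 /c /h.
  case: x {step2} => [[|m]|[|m]].
  - rewrite (_ : absz (Posz 0 + 1) = 1%N)// (_ : absz (Posz 0 - 1) = 1%N)//=.
    by rewrite expr0 expr1; lra.
  - rewrite (_ : absz (m.+1%:Z + 1) = m.+2); last by lia.
    rewrite (_ : absz (m.+1%:Z - 1) = m); last by lia.
    by rewrite /= !exprS mulr0 add0r; field.
  - rewrite (_ : absz (Negz 0 + 1) = 0%N)// (_ : absz (Negz 0 - 1) = 2%N)//=.
    by rewrite expr0 expr1 expr2 mulr0 add0r; lra.
  rewrite (_ : absz (Negz m.+1 + 1) = m.+1); last by lia.
  rewrite (_ : absz (Negz m.+1 - 1) = m.+3); last by lia.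
  by rewrite /= !exprS mulr0 add0r; field.
(* The equation [hE] unfolded [n] times; the remainder vanishes because the iterates stay in [0, 1]
   and [c < 1]. *)
have iterE n x : h x = 2^-1 * (\sum_(k < n) c ^+ k * return_prob R 2 k x) +
    c ^+ n * iter n (step_mean 2) h x.
  elim: n x => [|n IH] x; first by rewrite big_ord0 expr0 mulr0 add0r mul1r.
  rewrite {1}hE (step_mean_ext _ _ IH) step_meanD !step_meanZ.
  rewrite (step_mean_sum _ _ (fun k y => c ^+ k * return_prob R 2 k y)).
  rewrite big_ord_recl /= expr0 mul1r mulrDr mulrDr addrA.
  congr (_ + _ + _); last by rewrite mulrA -exprS.
  rewrite mulrCA; congr (_ * _); rewrite mulr_sumr; apply: eq_bigr => k _.
  by rewrite step_meanZ mulrA -exprS.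
have iter01 n x : 0 <= iter n (step_mean 2) h x <= 1.
  elim: n x => [|n IH] x /=.
    by rewrite /h exprn_ge0 ?invr_ge0//= exprn_ile1 ?invr_ge0// invf_le1 ?ltr0n// ler1n.
  rewrite -{1}(step_mean_cst (isT : (0 < 2)%N) 0 x).
  rewrite -(step_mean_cst (isT : (0 < 2)%N) 1 x).
  by rewrite !step_mean_le// => y; case/andP: (IH y).
have c0 : c ^+ n @[n --> \oo] --> 0.
  by apply: cvg_expr; rewrite /c ger0_norm; lra.
have r0 : c ^+ n.+1 * iter n.+1 (step_mean 2) h 0 @[n --> \oo] --> 0.
  have := cvg_shiftS (fun n => c ^+ n * iter n (step_mean 2) h 0) (nbhs (0 : R)) => /= ->.
  apply: (squeeze_cvgr _ (cvg_cst 0) c0); apply: nearW => n.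
  have /andP[i0 i1] := iter01 n 0.
  have cn : 0 <= c ^+ n by rewrite exprn_ge0// /c; lra.
  by rewrite mulr_ge0//= ler_piMr.
(* At the origin [h] and the term [k = 0] both equal 1, so the partial sum [S] from time 1 on
   satisfies [1 = (1 + S) / 2 + remainder]. *)
have -> : series (fun k => return_prob R 2 k.+1 0 * (3 / 4) ^+ k.+1) =
    (fun n => 1 - 2 * (c ^+ n.+1 * iter n.+1 (step_mean 2) h 0)).
  apply/funext => n; have := iterE n.+1 0.
  rewrite big_ord_recl {1}/h /= !expr0 /series /= big_mkord.
  rewrite (eq_bigr (fun k : 'I_n => return_prob R 2 k.+1 0 * (3 / 4) ^+ k.+1));
    first by lra.
  by move=> k _; rewrite /bump /= add1n mulrC.
have := cvgB (cvg_cst (1 : R)) (cvgM (cvg_cst (2 : R)) r0).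
by rewrite mulr0 subr0; exact.
Qed.

(** * Trajectories of the two walks *)

Lemma walk_sum_take M n (x0 : 'I_M) (a : n.-tuple 'I_M) l : (l < n)%N ->
  walk_sum (take l.+1 a) = (walk_sum (take l a) + (nth x0 a l).+1)%N.
Proof.
by move=> ln; rewrite (take_nth x0) ?size_tuple// /walk_sum big_rcons.
Qed.

Lemma walk_sum_take_inj M n (a b : n.-tuple 'I_M) :
  (forall l, (l <= n)%N -> walk_sum (take l a) = walk_sum (take l b)) -> a = b.
Proof.
move=> h; apply: eq_from_tnth => i.
have := h i.+1 (ltn_ord i).
rewrite !(walk_sum_take (tnth a i))// (h i (ltnW (ltn_ord i))) => /addnI[].
by rewrite -!tnth_nth => /val_inj.
Qed.

Section WalkLaw.
Context (d : measure_display) (T : measurableType d) (R : realType).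
Variable P : probability T R.

(** Phrased with the walk and not with its steps, so that the event lies in the sigma-algebra
    [sigma_process S], on which independence of the two walks is assumed. *)
Definition trajectory (M n : nat) (S : nat -> {RV P >-> int}) (a : seq 'I_M) : set T :=
  [set w | forall l, (l <= n)%N -> S l w = (walk_sum (take l a))%:Z].

Lemma measurable_RV_preimage (X : {RV P >-> int}) (A : set int) : measurable (X @^-1` A).
Proof. by rewrite -[X in measurable X]setTI; apply: measurable_funP. Qed.

Lemma trajectoryE M n S (a : seq 'I_M) :
  trajectory n S a = \bigcap_(l in `I_n.+1) S l @^-1` [set (walk_sum (take l a))%:Z].
Proof. by apply/seteqP; split => w /= h l; have := h l. Qed.

Lemma measurable_trajectory M n S (a : seq 'I_M) : measurable (trajectory n S a).
Proof.
rewrite trajectoryE; apply: bigcap_measurableType => // l _.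
exact: measurable_RV_preimage.
Qed.

Lemma sigma_process_trajectory M n S (a : seq 'I_M) :
  sigma_process S (trajectory n S a).
Proof.
rewrite trajectoryE.
pose G := [set E | exists (n : nat) (A : set int), measurable A /\ E = S n @^-1` A].
have := @bigcap_measurableType _ (g_sigma_algebraType G)
  (fun l => S l @^-1` [set (walk_sum (take l a))%:Z]) `I_n.+1.
apply => // l _; apply: sub_sigma_algebra; exists l.
by exists [set (walk_sum (take l a))%:Z].
Qed.

(** Positions up to time [n] and the first [n] steps determine each other, so the event is an
    intersection of [n] independent step events of probability [1 / M]. *)
Lemma prob_trajectory M n S (a : n.-tuple 'I_M) : (0 < M)%N ->
  uniform_walk M S -> P (trajectory n S a) = ((M%:R^-1) ^+ n)%:E.
Proof.
move=> M_gt0 [S0 [X [SX Xind Xunif]]].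
pose x0 := Ordinal M_gt0.
pose A i : set int := [set (nth x0 a i).+1%:Z].
pose I : {fset nat} := [fset i in iota 0 n]%fset.
have II i : (i \in I) = (i < n)%N by rewrite !inE mem_iota.
have -> : trajectory n S a = \bigcap_(i in [set` I]) (X i @^-1` A i).
  apply/seteqP; split => w /= h.
    move=> i; rewrite /= II => li; rewrite /A /=.
    have := SX i w; rewrite (h i.+1)// (h i (ltnW li)) (walk_sum_take x0)// PoszD.
    by move/addrI.
  elim=> [_|l IH ln]; first by rewrite S0 take0 /walk_sum big_nil.
  rewrite SX IH 1?ltnW// (walk_sum_take x0)// PoszD; congr (_ + _).
  by apply: (h l); rewrite /= II.
rewrite Xind//.
rewrite (eq_big_seq (fun=> (M%:R^-1)%:E)); last first.
  move=> i; rewrite II => _.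
  rewrite Xunif (_ : (1 <= _ <= _) = true)//.
  by have := ltn_ord (nth x0 a i); lia.
rewrite big_const_seq count_predT.
have -> : size I = n.
  by rewrite -[size _]/(#|` I|)%fset card_fseq undup_id ?iota_uniq// size_iota.
elim: n {a x0 A I II} => [|n IH]; first by rewrite expr0.
by rewrite iterS IH exprS EFinM.
Qed.

(** The events need only cover the space up to a null set, as steps may leave 1, ..., M with
    probability 0. The complement of their union is dropped from the integral. *)
Lemma expectation_finite_partition (I : finType) (E : I -> set T)
    (f : T -> R) (c : I -> R) :
  (forall i, measurable (E i)) -> trivIset setT E -> (\sum_i P (E i) = 1)%E ->
  measurable_fun setT f -> (forall w, 0 <= f w) -> (forall i w, E i w -> f w = c i) ->
  ('E_P[f] = \sum_i (c i)%:E * P (E i))%E.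
Proof.
move=> mE tE sumE mf f0 fc.
have /measurable_EFinP mef := mf.
pose D := \big[setU/set0]_(i : I) E i.
have mD : measurable D by apply: bigsetU_measurable.
have PD : P D = 1%E.
  rewrite -[LHS]mul1e -integral_cst// /D ge0_integral_bigsetU//=.
  - rewrite -[RHS]sumE; apply: eq_bigr => i _.
    by rewrite integral_cst// mul1e.
  - exact: index_enum_uniq.
  - exact: sub_trivIset tE.
rewrite unlock /=.
have PDC : P (~` D) = 0%E by rewrite probability_setC// PD subee.
have ef0 w : [set: T] w -> (0 <= (f w)%:E)%E by rewrite lee_fin.
rewrite (ge0_negligible_integral (measurableC mD) measurableT mef ef0 PDC).
rewrite setTD setCK /D ge0_integral_bigsetU//=.
- apply: eq_bigr => i _.
  rewrite (eq_integral (fun=> (c i)%:E)); last first.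
    by move=> w; rewrite inE => /fc ->.
  by rewrite integral_cst.
- exact: index_enum_uniq.
- exact: sub_trivIset tE.
- exact: measurable_funTS.
- by move=> w _; rewrite lee_fin.
Qed.

Lemma visitsE (J K : nat -> {RV P >-> int}) n w :
  visits J K n w = (\sum_(l < n) (J l.+1 w == K l.+1 w))%N.
Proof.
rewrite /visits -sum1_card big_mkcond big_ord_recl /= add0n.
by apply: eq_bigr => l _; rewrite inE /=; case: eqP.
Qed.

(** The power is a product of factors [1 + indicator]. Each coincidence event is a countable union
    over the common value, split along the two constructors of [int]. *)
Lemma measurable_visits (J K : nat -> {RV P >-> int}) n :
  measurable_fun setT (fun w => 2 ^+ visits J K n w : R).
Proof.
have mE l : measurable [set w | J l w = K l w].
  pose both (k : int) := J l @^-1` [set k] `&` K l @^-1` [set k].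
  have mboth k : measurable (both k).
    by apply: measurableI; apply: measurable_RV_preimage.
  rewrite (_ : mkset _ = (\bigcup_m both (Posz m)) `|` \bigcup_m both (Negz m)).
    by apply: measurableU; apply: bigcup_measurable.
  apply/seteqP; split => [w /= e|w [] [k _ [/= -> ->]]//].
  by case E : (K l w) (e) => [m|m] e'; [left|right]; exists m.
rewrite (_ : (fun w => _) =
  fun w => \prod_(l < n) (1 + \1_[set w | J l.+1 w = K l.+1 w] w)).
  apply: measurable_prod => l _; apply: measurable_funD.
    exact: measurable_cst.
  exact: measurable_indic.
apply/funext => w; rewrite visitsE expr_sum; apply: eq_bigr => l _.
rewrite indicE; case: eqP => h; first by rewrite mem_set.
by rewrite memNset// addr0 expr0.
Qed.

(** The pairs of trajectories form [M^(2n)] disjoint events of equal probability, on each of which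
    the number of visits is constant. *)
Lemma expectation_visits M (J K : nat -> {RV P >-> int}) n : (0 < M)%N ->
  uniform_walk M J -> uniform_walk M K -> independent_processes J K ->
  ('E_P[fun w : T => (2 ^+ visits J K n w : R)%R] = (visit_mean R M n 0)%:E)%E.
Proof.
move=> M_gt0 UJ UK ind.
pose E (p : n.-tuple 'I_M * n.-tuple 'I_M) := trajectory n J p.1 `&` trajectory n K p.2.
pose c (p : n.-tuple 'I_M * n.-tuple 'I_M) : R :=
  2 ^+ (\sum_(l < n) (0 + (walk_sum (take l.+1 p.1))%:Z
                      - (walk_sum (take l.+1 p.2))%:Z == 0%R)%R).
have PE p : P (E p) = ((M%:R^-1) ^+ (2 * n))%:E.
  rewrite /E ind; [|exact: sigma_process_trajectory..].
  by rewrite !prob_trajectory// -EFinM -exprD addnn mul2n.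
rewrite (expectation_finite_partition (E := E) (c := c)).
- under eq_bigr => p _ do rewrite PE -EFinM.
  rewrite sumEFin visit_mean_tuple// -mulr_suml mulrC; congr ((_ * _)%:E).
  by rewrite pair_big.
- by move=> p; apply: measurableI; apply: measurable_trajectory.
- move=> [a b] [a' b'] _ _ [w [[/= ha hb] [/= ha' hb']]].
  by congr pair; apply: walk_sum_take_inj => l ln; have := ha l ln; have := hb l ln;
    rewrite (ha' l ln) (hb' l ln) => -[+] [].
- under eq_bigr => p _ do rewrite PE.
  rewrite sumEFin sumr_const card_prod card_tuple card_ord -expnD addnn -mul2n.
  rewrite exprVn -[_ *+ (M ^ _)%N]mulr_natl natrX divff// expf_neq0// pnatr_eq0; lia.
- exact: measurable_visits.
- by move=> w; rewrite exprn_ge0.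
move=> [a b] w [/= ha hb]; rewrite visitsE /c; congr (_ ^+ _).
apply: eq_bigr => l _ /=.
by rewrite (ha _ (ltn_ord l)) (hb _ (ltn_ord l)) add0r subr_eq0.
Qed.

End WalkLaw.

(** * Convergence *)

(** Multiplying [visit_mean_renewal] by [s^n] gives a renewal equation with weights [p] of total
    mass 1 and forcing term [s^n], whose sum is [1 / (1 - s)]. *)
Lemma visit_mean_cvg (R : realType) (M : nat) (s : R) : (0 < M)%N -> 0 < s -> s < 1 ->
  series (fun k => return_prob R M k.+1 0 * s ^+ k.+1) n @[n --> \oo] --> (1 : R) ->
  exists2 C : R, 0 < C & visit_mean R M n 0 * s ^+ n @[n --> \oo] --> C.
Proof.
move=> M_gt0 s0 s1.
pose p k : R := return_prob R M k.+1 0 * s ^+ k.+1.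
rewrite -/p => p_cvg1.
have p_ge0 n : 0 <= p n.
  by rewrite mulr_ge0 ?exprn_ge0 ?(ltW s0)//;
    case/andP: (return_prob_bound R M_gt0 n.+1 0).
have pcvg : cvgn (series p) by apply/cvg_ex; exists 1.
pose r n := 1 - series p n.
have r_ge0 n : 0 <= r n.
  rewrite subr_ge0 -(cvg_lim _ p_cvg1)//; apply: nondecreasing_cvgn_le => //.
  exact: nondecreasing_series.
have r0 : r 0%N = 1 by rewrite /r /series /= big_geq// subr0.
have rS n : r n.+1 = r n - p n.
  by rewrite /r /series /= big_nat_recr//= opprD addrA.
have sV : 0 < (1 - s)^-1 by rewrite invr_gt0 subr_gt0.
have s_cvg0 : s ^+ n @[n --> \oo] --> 0 by apply: cvg_expr; rewrite ger0_norm ?(ltW s0).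
(* Since return probabilities are at most 1, [p m <= s^m], so [a] decreases to 1 and stays above it.
   This geometric bound makes the mean waiting time finite. *)
have r_le n : r n <= geometric (1 - s)^-1 s n.
  rewrite /= /r lerBlDl; pose a m := series p m + (1 - s)^-1 * s ^+ m.
  have a_cvg : a m @[m --> \oo] --> (1 : R).
    by have := cvgD p_cvg1 (cvgM (cvg_cst (1 - s)^-1) s_cvg0); rewrite mulr0 addr0; apply.
  have acvg : cvgn a by apply/cvg_ex; exists 1.
  rewrite -[leLHS](cvg_lim _ a_cvg)//; apply: (nonincreasing_cvgn_ge (u_ := a) _ acvg n).
  apply/nonincreasing_seqP => m; rewrite /a /series /= big_nat_recr//=.
  rewrite -addrA lerD2l.
  have -> : (1 - s)^-1 * s ^+ m = s ^+ m + (1 - s)^-1 * s ^+ m.+1.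
    by rewrite exprS; field; lra.
  rewrite lerD2r /p; have /andP[u0 u1] := return_prob_bound R M_gt0 m.+1 0.
  rewrite exprS mulrA ler_piMl ?exprn_ge0 ?(ltW s0)// mulr_ile1 ?(ltW s0) ?(ltW s1)//.
have rcvg : cvgn (series r).
  apply: (@series_le_cvg _ r (geometric (1 - s)^-1 s)) => //.
    by move=> n; rewrite /= mulr_ge0 ?exprn_ge0 ?(ltW s0) ?(ltW sV).
  by apply: is_cvg_geometric_series; rewrite ger0_norm ?(ltW s0).
have mu_gt0 : 0 < limn (series r).
  apply: (@lt_le_trans _ _ (series r 1)); first by rewrite /series /= big_nat1 r0.
  by apply: nondecreasing_cvgn_le => //; apply: nondecreasing_series.
exists (1 / (1 - s) / limn (series r)); first by rewrite !divr_gt0// subr_gt0.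
apply: (renewal_cvg (p := p) (r := r) (g := geometric 1 s)) => //.
- by rewrite mulr_gt0// ?expr1// return_prob1_gt0.
- by move=> n; rewrite /= mul1r exprn_ge0// ltW.
- by apply: cvg_geometric_series; rewrite ger0_norm ?(ltW s0).
move=> n; rewrite visit_mean_renewal// mulrDl; congr (_ + _).
rewrite mulr_suml; apply: eq_bigr => k _; rewrite subSS /p.
have -> : s ^+ n.+1 = s ^+ k.+1 * s ^+ (n - k).
  by rewrite -exprD -subSS subnKC// ltn_ord.
by ring.
Qed.

(** For [M = 2] the explicit root is supplied directly, so the root from [power_series_root] need
    not be identified with it. *)
Lemma return_series_root (R : realType) (M : nat) : (0 < M)%N ->
  exists s : R, [/\ 0 < s, s < 1, (M = 2%N -> s = 3 / 4) &
    series (fun k => return_prob R M k.+1 0 * s ^+ k.+1) n @[n --> \oo] --> (1 : R)].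
Proof.
move=> M_gt0; have [->|M2] := eqVneq M 2%N.
  exists (3 / 4); split => [||//|]; [lra|lra|exact: return_prob2_series].
have [s [s0 s1 hs]] := power_series_root (fun n => return_prob_bound R M_gt0 n.+1 0)
  (return_prob_diverges R M_gt0).
by exists s; split => // /eqP; rewrite (negPf M2).
Qed.

Theorem mainTheorem5 (R : realType) (M : nat) (hM : (1 <= M)%N) :
  exists cM C : R,
    [/\ 1 < cM, 0 < C, (M = 2%N -> cM = 4 / 3) &
      forall (d : measure_display) (T : measurableType d)
             (P : probability T R) (J K : nat -> {RV P >-> int}),
        uniform_walk M J -> uniform_walk M K -> independent_processes J K ->
        ('E_P[fun w : T => (2 ^+ visits J K n w : R)%R] / (cM ^+ n)%:E)%E
          @[n --> \oo] --> C%:E].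
Proof.
have [s [s0 s1 s2 hs]] := return_series_root R hM.
have [C C0 hC] := visit_mean_cvg hM s0 s1 hs.
exists s^-1, C; split => //; first by rewrite invf_gt1.
  by move=> /s2 ->; field.
move=> d T P J K UJ UK ind.
rewrite (_ : (fun n => _) = fun n => (visit_mean R M n 0 * s ^+ n)%:E).
  by apply: cvg_EFin => //; exact: nearW.
apply/funext => n; rewrite (expectation_visits n hM UJ UK ind).
by rewrite inver expf_eq0 invr_eq0 (gt_eqF s0) andbF exprVn invrK EFinM.
Qed.
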